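(* Let $A$ be a commutative unital real algebra and let $A_1,\dots,A_m$, $m\in\mathbb{N}$, be subalgebras of $A$, each containing the unit element of $A$, such that the algebra $A$ is generated by $A_1,\dots,A_m$. For each $i=1,\dots,m$ let $C_i$ be an Archimedean semiring or an Archimedean quadratic module of the algebra $A_i$. Let $M$ be a unital cone of $A$. Then $\mathrm{cone}(C_1,\dots,C_m)^\dagger$ is an Archimedean preordering of the algebra $A$, and $\mathrm{cone}(M,\mathrm{cone}(C_1,\dots,C_m)^\dagger)$ is a $\mathrm{cone}(C_1,\dots,C_m)^\dagger$-module.
   Context: For $\alpha\in\mathbb{R}$ we write $\alpha$ for $\alpha\cdot 1$ in an algebra. Let $B$ be a commutative unital real algebra. A cone in $B$ is a subset $C\subseteq B$ with $\lambda c\in C$ and $c+d\in C$ for all $c,d\in C$ and real $\lambda\ge 0$; it is unital if $1\in C$. A unital cone $C$ of $B$ is: - a quadratic module of $B$ if $a^2b\in C$ for all $b\in C$, $a\in B$; - a semiring of $B$ if $C\cdot C\subseteq C$; - a preordering of $B$ if it is both a quadratic module and a semiring of $B$; - Archimedean (in $B$) if for each $a\in B$ there is $\lambda>0$ with $\lambda-a\in C$ and $\lambda+a\in C$. For a semiring $C$ of $A$, a unital cone $N$ of $A$ is called a $C$-module if $ac\in N$ for all $a\in N$ and $c\in C$. If $C_1,\dots,C_n$ are unital cones of subalgebras of $A$ (each containing $1$; a subalgebra may be $A$ itself), then $\mathrm{cone}(C_1,\dots,C_n)$ is the set of all finite sums $\sum_{k=1}^r c_{1k}\cdots c_{nk}$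 with $r\in\mathbb{N}$ and $c_{jk}\in C_j$. For a unital cone $C$ of $A$, $C^\dagger:=\{a\in A:\ a+\epsilon\in C\text{ for all }\epsilon\in(0,\infty)\}$. *)

(* Defs.v *)
From HB Require Import structures.
From mathcomp Require Import all_boot all_order all_algebra.
From mathcomp Require Import all_classical all_reals.

Set Implicit Arguments.
Unset Strict Implicit.
Unset Printing Implicit Defensive.

Import Order.TTheory GRing.Theory Num.Theory.
Local Open Scope classical_set_scope.
Local Open Scope ring_scope.

(* A commutative unital real algebra is a commutative ring A, possibly zero,
   with a structure morphism iota : R -> A: the scalar multiple of a by l is
   iota l * a, and the element l . 1 of A is iota l.  (MathComp's comAlgType,
   where iota would be in_alg A, excludes the zero algebra.) *)
Section Cones.
Variables (R : realType) (A : comPzRingType) (iota : {rmorphism R -> A}).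
Implicit Types (B C D N : set A).

(* Subalgebras containing 1; same clauses as GRing.subalg_closed. *)
Definition subalgebra B : Prop :=
  [/\ B 1,
      forall (l : R) a b, B a -> B b -> B (iota l * a + b) &
      forall a b, B a -> B b -> B (a * b)].

Definition generated_subalgebra (I : Type) (B : I -> set A) : set A :=
  smallest subalgebra (\bigcup_i B i).

(* Below, "P B C" says that C is a P of the subalgebra B. *)
Definition is_cone B C : Prop :=
  [/\ C `<=` B,
      forall (l : R) c, 0 <= l -> C c -> C (iota l * c) &
      forall c d, C c -> C d -> C (c + d)].

Definition unital_cone B C : Prop := is_cone B C /\ C 1.

Definition quadratic_module B C : Prop :=
  unital_cone B C /\ forall a b, B a -> C b -> C (a ^+ 2 * b).

Definition semiring B C : Prop :=
  unital_cone B C /\ forall c d, C c -> C d -> C (c * d).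

Definition preordering B C : Prop := quadratic_module B C /\ semiring B C.

Definition archimedean B C : Prop :=
  forall a, B a ->
    exists l : R, [/\ 0 < l, C (iota l - a) & C (iota l + a)].

Definition cone_module C N : Prop :=
  [/\ semiring setT C, unital_cone setT N &
      forall a c, N a -> C c -> N (a * c)].

Definition cone (n : nat) (C : 'I_n -> set A) : set A :=
  [set x | exists (r : nat) (c : 'I_n -> 'I_r -> A),
     (forall j k, C j (c j k)) /\ x = \sum_(k < r) \prod_(j < n) c j k].

Definition cone2 C D : set A := cone (tnth [tuple C; D]).

Definition dagger C : set A :=
  [set a | forall eps : R, 0 < eps -> C (a + iota eps)].

End Cones.

(* Main.v *)
Require Import Defs.
From HB Require Import structures.
From mathcomp Require Import all_boot all_order all_algebra ring.
From mathcomp Require Import all_classical all_reals.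

Set Implicit Arguments.
Unset Strict Implicit.
Unset Printing Implicit Defensive.

Import Order.TTheory GRing.Theory Num.Theory.
Local Open Scope classical_set_scope.
Local Open Scope ring_scope.

(** Write x <= y for y - x in a given unital cone.  The proof is purely
algebraic: no states, extreme points or characters occur, and every passage to
the limit is an explicit estimate of the form n a + mu in C for all n, which
puts a in the closure of C ([dagger_of_multiples]).

The heart of the matter is one algebra at a time.  If C is an Archimedean
semiring or quadratic module, its closure is a semiring
([archimedean_dagger_semiring]).  For a semiring this is a perturbation
argument.  For a quadratic module, take a, b in C with a <= 1 and iterate
u |-> u - u^2 from u_0 = a.  The u_k stay between 0 and 1, and
a = u_0^2 + ... + u_(n-1)^2 + u_n, so that a b >= u_k b for all k, while the
sum of the u_k^2 is at most 1.  Averaging the lower bounds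
2 N u_k b >= - N^2 u_k^2 - b^2 over k < N^2 makes the product a b nonnegative up
to an arbitrarily small error ([quadratic_module_mul_unit]).  In the semiring
case one needs moreover that squares lie in the closure; this comes from the
second moment of a random walk with drift x ([semiring_sqr_dagger]).

For several algebras, let D_i be the closure of C_i.  The products of elements
of the subalgebras span A, and multilinearity shows that such products are
bounded, so that cone(C_1, ..., C_m) is Archimedean ([cone_archimedean]).
Exchanging one factor at a time, cone(C_1, ..., C_m) and cone(D_1, ..., D_m)
have the same closure ([cone_dagger]).  The latter cone is a semiring because
the D_i are, and the one-algebra results apply to it.  The claim on modules then
follows since the second factor of each product m p absorbs elements of the
closure. *)

Section Dagger.
Variables (R : realType) (A : comPzRingType) (iota : {rmorphism R -> A}).
Implicit Types (B C D N : set A).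

(** With this notion, [archimedean iota B C] unfolds to
[forall a, B a -> bounded C a]. *)
Definition bounded C (a : A) : Prop :=
  exists l : R, [/\ 0 < l, C (iota l - a) & C (iota l + a)].

(** * Unital cones *)

Lemma subalgebra_scalar B l : subalgebra iota B -> B (iota l).
Proof.
case=> B1 Blin _.
have -> : iota l = iota (l - 1) * 1 + 1 by ring.
exact: Blin.
Qed.

Lemma subalgebraD B a b : subalgebra iota B -> B a -> B b -> B (a + b).
Proof. by case=> _ Blin _ Ba Bb; rewrite -(mul1r a) -(rmorph1 iota); apply: Blin. Qed.

Lemma subalgebraB B a b : subalgebra iota B -> B a -> B b -> B (a - b).
Proof.
case=> _ Blin _ Ba Bb; have -> : a - b = iota (-1) * b + a by ring.
exact: Blin.
Qed.

Lemma unital_cone_scalar B C l : unital_cone iota B C -> 0 <= l -> C (iota l).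
Proof. by move=> [[_ Cs _] C1] l0; rewrite -(mulr1 (iota l)); apply: Cs. Qed.

Lemma unital_coneMn B C n c : unital_cone iota B C -> C c -> C (n%:R * c).
Proof.
by move=> [[_ Cs _] _] Cc; rewrite -(rmorph_nat iota); apply: Cs; rewrite ?ler0n.
Qed.

Lemma unital_cone_unscale B C l c : unital_cone iota B C ->
  0 < l -> C (iota l * c) -> C c.
Proof.
move=> [[_ Cs _] _] l0 /(Cs l^-1 _ (ltW _)).
by rewrite invr_gt0 mulrA -rmorphM mulVf ?gt_eqF// rmorph1 mul1r; apply.
Qed.

Lemma unital_cone_undivn B C n c : unital_cone iota B C ->
  C (n.+1%:R * c) -> C c.
Proof.
move=> uC; rewrite -(rmorph_nat iota).
by apply: (unital_cone_unscale uC); rewrite ltr0n.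
Qed.

Lemma boundedN C a : bounded C a -> bounded C (- a).
Proof. by case=> l [l0 ? ?]; exists l; rewrite opprK. Qed.

Lemma boundedD B C a b : unital_cone iota B C ->
  bounded C a -> bounded C b -> bounded C (a + b).
Proof.
move=> [[_ _ CD] _] [l [l0 la la']] [k [k0 kb kb']].
exists (l + k); split; first exact: addr_gt0.
- have -> : iota (l + k) - (a + b) = (iota l - a) + (iota k - b) by ring.
  exact: CD.
- have -> : iota (l + k) + (a + b) = (iota l + a) + (iota k + b) by ring.
  exact: CD.
Qed.

Lemma bounded_scale B C s a : unital_cone iota B C ->
  bounded C a -> bounded C (iota s * a).
Proof.
move=> uC.
have nonneg t b : 0 <= t -> bounded C b -> bounded C (iota t * b).
  move=> t0 [l [l0 lb lb']]; have [[_ Cs CD] C1] := uC.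
  exists (t * l + 1); split.
  - by rewrite ltr_wpDl// mulr_ge0// ltW.
  - have -> : iota (t * l + 1) - iota t * b = iota t * (iota l - b) + 1 by ring.
    by apply: (CD) => //; apply: Cs.
  - have -> : iota (t * l + 1) + iota t * b = iota t * (iota l + b) + 1 by ring.
    by apply: (CD) => //; apply: Cs.
have [s0|s0] := leP 0 s; first exact: nonneg.
move=> ba; have -> : iota s * a = iota (- s) * (- a) by ring.
by apply: nonneg (boundedN ba); rewrite oppr_ge0 ltW.
Qed.

(** * The closure of a unital cone *)

Lemma subset_dagger B C : unital_cone iota B C -> C `<=` dagger iota C.
Proof.
move=> uC a Ca e e0; have [[_ _ CD] _] := uC.
by apply: (CD) => //; apply: (unital_cone_scalar uC); apply: ltW.
Qed.

Lemma dagger_mono C D : C `<=` D -> dagger iota C `<=` dagger iota D.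
Proof. by move=> CD a Ca e e0; apply/CD/Ca. Qed.

Lemma dagger_idem C : dagger iota (dagger iota C) `<=` dagger iota C.
Proof.
move=> a Ca e e0; have e2 : 0 < e / 2 by rewrite divr_gt0.
by have := Ca _ e2 _ e2; rewrite -addrA -rmorphD -splitr.
Qed.

(** All limit arguments below end here: dividing by n.+1 bounds the
perturbation by mu / n.+1, which is eventually below any given positive
number. *)
Lemma dagger_of_multiples B C a mu : unital_cone iota B C ->
  (forall n, C (n.+1%:R * a + iota mu)) -> dagger iota C a.
Proof.
move=> uC Ca e e0; have [[_ _ CD] _] := uC.
have [n mun] : exists n : nat, mu <= n.+1%:R * e.
  exists (Num.truncn (mu / e)); rewrite -ler_pdivrMr//.
  exact/ltW/truncnS_gt.
apply: (@unital_cone_undivn B C n) => //.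
have -> : n.+1%:R * (a + iota e)
   = (n.+1%:R * a + iota mu) + iota (n.+1%:R * e - mu) by ring.
by apply: (CD) => //; apply: (unital_cone_scalar uC); rewrite subr_ge0.
Qed.

Lemma dagger_unital_cone B C : subalgebra iota B -> unital_cone iota B C ->
  unital_cone iota B (dagger iota C).
Proof.
move=> sB uC; have [[CB Cs CD] C1] := uC; split; last exact: (subset_dagger uC).
split=> [a Ca|l c l0 Cc e e0|c d Cc Cd e e0].
- have -> : a = (a + iota 1) - iota 1 by ring.
  apply: (subalgebraB sB); last exact: subalgebra_scalar.
  by apply/CB/Ca.
- move: l0; rewrite le_eqVlt => /predU1P[<-|l0].
    by rewrite rmorph0 mul0r add0r; apply: (unital_cone_scalar uC); apply: ltW.
  have -> : iota l * c + iota e = iota l * (c + iota (e / l)).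
    by rewrite mulrDr -rmorphM mulrC; congr (_ + iota _); field; rewrite gt_eqF.
  by apply: Cs (ltW l0) _; apply: Cc; rewrite divr_gt0.
- have -> : c + d + iota e = (c + iota (e / 2)) + (d + iota (e / 2)).
    by rewrite {1}(splitr e); ring.
  by apply: (CD); [apply: Cc|apply: Cd]; rewrite divr_gt0.
Qed.

(** For a, b in the closure and d > 0, the product (a + d)(b + d) is in the
closure, and it exceeds a b by d (a + b) + d^2, which is O(d) because a + b is
bounded. *)
Lemma dagger_semiring B C : subalgebra iota B -> unital_cone iota B C ->
  archimedean iota B C ->
  (forall a b, C a -> C b -> dagger iota C (a * b)) ->
  semiring iota B (dagger iota C).
Proof.
move=> sB uC aC CM; have uD := dagger_unital_cone sB uC; split=> // a b Da Db.
have [[DB _ DD] _] := uD.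
have [l [_ lab _]] := aC _ (subalgebraD sB (DB _ Da) (DB _ Db)).
apply: dagger_idem; apply: (@dagger_of_multiples B _ _ (l + 1) uD) => n.
(* Multiplied by n.+1 = 1 / d, the excess is a + b + d <= l + 1. *)
set d : R := n.+1%:R^-1.
have d0 : 0 < d by rewrite invr_gt0 ltr0n.
have nd : n.+1%:R * iota d = 1 :> A.
  by rewrite -(rmorph_nat iota) -rmorphM mulfV ?rmorph1// pnatr_eq0.
have -> : n.+1%:R * (a * b) + iota (l + 1)
  = n.+1%:R * ((a + iota d) * (b + iota d))
    + ((iota l - (a + b)) + iota (1 - d)).
  rewrite mulrDl !mulrDr [in iota d * _]mulrC.
  have E x : n.+1%:R * (x * iota d) = x by rewrite mulrCA nd mulr1.
  by rewrite !E; ring.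
apply: (DD); first by apply: (unital_coneMn _ uD); apply: CM; [apply: Da|apply: Db].
apply: (DD); first exact: (subset_dagger uC).
by apply: (unital_cone_scalar uD); rewrite subr_ge0 invf_le1 ?ltr0n// ler1n.
Qed.

(** * Squares in Archimedean semirings *)

(** The element is the second moment of the endpoint of a walk of n steps
started at s, where a step is 1 with probability (1 + x) / 2 and -1 with
probability (1 - x) / 2: the mean is s + n x and the variance n (1 - x^2).
Conditioning on the first step writes it as a combination of products of 1 + x
and 1 - x with nonnegative coefficients.  The start s is arbitrary so that the
induction can move it. *)
Lemma semiring_random_walk B C x s n : semiring iota B C ->
  C (1 - x) -> C (1 + x) ->
  C ((iota s + n%:R * x) ^+ 2 + n%:R * (1 - x ^+ 2)).
Proof.
move=> [uC CM] Cq Cp; have [[_ _ CD] _] := uC.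
elim: n s => [|n IHn] s.
  rewrite !mul0r !addr0 -rmorphXn.
  by apply: (unital_cone_scalar uC); apply: sqr_ge0.
apply: (@unital_cone_undivn B C 1) => //.
set p := (X in C X).
have -> : p =
  (1 + x) * ((iota (s + 1) + n%:R * x) ^+ 2 + n%:R * (1 - x ^+ 2)) +
  (1 - x) * ((iota (s - 1) + n%:R * x) ^+ 2 + n%:R * (1 - x ^+ 2)).
  by rewrite /p; ring.
by apply: (CD); apply: CM.
Qed.

(** For a scaled to x between -1 and 1, a walk of n.+2 steps from 0 has second
moment n.+2 (n.+1 x^2 + 1). *)
Lemma semiring_sqr_dagger B C a : subalgebra iota B -> semiring iota B C ->
  archimedean iota B C -> B a -> dagger iota C (a ^+ 2).
Proof.
move=> sB sC aC Ba; have [uC _] := sC.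
have [l [l0 la la']] := aC _ Ba.
pose x := iota l^-1 * a.
have ll : iota l * iota l^-1 = 1 by rewrite -rmorphM mulfV ?rmorph1 ?gt_eqF.
have ax : a = iota l * x by rewrite mulrA ll mul1r.
have Cq : C (1 - x).
  by apply: (unital_cone_unscale uC l0); rewrite mulrBr mulr1 -ax.
have Cp : C (1 + x).
  by apply: (unital_cone_unscale uC l0); rewrite mulrDr mulr1 -ax.
have uD := dagger_unital_cone sB uC; have [[_ Ds _] _] := uD.
rewrite ax exprMn -rmorphXn; apply: Ds; first exact: sqr_ge0.
apply: (@dagger_of_multiples B _ _ 1 uC) => n.
apply: (@unital_cone_undivn B C n.+1) => //.
have := semiring_random_walk 0 n.+2 sC Cq Cp.
by congr (C _); ring.
Qed.

(** * Closures of Archimedean semirings and quadratic modules *)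

(** A quadratic module need not contain a b, but subtracting squares times b
from a b stays below a b; iterating u |-> u - u^2 drives the factor a to 0 in
the mean, which is enough. *)
Lemma quadratic_module_mul_unit B C a b : subalgebra iota B ->
  quadratic_module iota B C -> archimedean iota B C ->
  C a -> C (1 - a) -> C b -> dagger iota C (a * b).
Proof.
move=> sB [uC CQ] aC Ca Ca' Cb.
have [[CB Cs CD] C1] := uC; have [_ _ BM] := sB.
have Csqr x : B x -> C (x ^+ 2) by move=> Bx; rewrite -[_ ^+ 2]mulr1; apply: CQ.
have BN n x : B x -> B (n%:R * x).
  by move=> Bx; rewrite -(rmorph_nat iota); apply: BM => //; exact: subalgebra_scalar.
pose u n := iter n (fun x => x - x ^+ 2) a.
have uS n : u n.+1 = u n - u n ^+ 2 by [].
have [Cu Cu'] : (forall n, C (u n)) /\ (forall n, C (1 - u n)).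
  suff H n : C (u n) /\ C (1 - u n) by split=> n; case: (H n).
  elim: n => [//|n [IH IH']]; rewrite uS; split.
    have -> : u n - u n ^+ 2 = (1 - u n) ^+ 2 * u n + u n ^+ 2 * (1 - u n) by ring.
    by apply: (CD); apply: CQ => //; apply: CB.
  have -> : 1 - (u n - u n ^+ 2) = (1 - u n) + u n ^+ 2 by ring.
  by apply: (CD) => //; apply/Csqr/CB.
have Cdrop n : C (a * b - u n * b).
  elim: n => [|n IH]; first by rewrite subrr -(rmorph0 iota); exact: (unital_cone_scalar uC).
  have -> : a * b - u n.+1 * b = (a * b - u n * b) + u n ^+ 2 * b by rewrite uS; ring.
  by apply: (CD) => //; apply: CQ => //; apply: CB.
(* The sum over k < n of 2 N (a b - u_k b) + (N u_k + b)^2; the squares u_k^2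
     telescope to a - u_n. *)
have Csum (N n : nat) :
    C ((2 * N * n)%:R * (a * b) + (N ^ 2)%:R * (a - u n) + n%:R * b ^+ 2).
  elim: n => [|n IH].
    have -> : (2 * N * 0)%:R * (a * b) + (N ^ 2)%:R * (a - u 0) + 0%:R * b ^+ 2 = iota 0.
      by rewrite /u /= muln0; ring.
    exact: (unital_cone_scalar uC).
  have -> : (2 * N * n.+1)%:R * (a * b) + (N ^ 2)%:R * (a - u n.+1) + n.+1%:R * b ^+ 2
     = ((2 * N * n)%:R * (a * b) + (N ^ 2)%:R * (a - u n) + n%:R * b ^+ 2)
       + ((2 * N)%:R * (a * b - u n * b) + (N%:R * u n + b) ^+ 2).
    by rewrite uS mulnS !natrD !natrM; ring.
  apply: (CD) => //; apply: (CD); first exact: (unital_coneMn _ uC).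
  by apply/Csqr/(subalgebraD sB); [apply/BN/CB|apply: CB].
(* Taking n = N^2 makes both error terms, N^2 (a - u_n) and n b^2, of order N^2,
   against a main term 2 N^3 a b. *)
have [l [_ lb _]] : bounded C (b ^+ 2) by apply/aC/BM; apply: CB.
have uD := dagger_unital_cone sB uC.
apply: (@unital_cone_undivn B _ 1 _ uD).
apply: (@dagger_of_multiples B _ _ (1 + l) uC) => n.
apply: (@unital_cone_undivn B C n) => //.
apply: (@unital_cone_undivn B C n) => //.
have -> : n.+1%:R * (n.+1%:R * (n.+1%:R * (2%:R * (a * b)) + iota (1 + l)))
  = ((2 * n.+1 * n.+1 ^ 2)%:R * (a * b) + (n.+1 ^ 2)%:R * (a - u (n.+1 ^ 2)%N)
       + (n.+1 ^ 2)%:R * b ^+ 2)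
    + (n.+1 ^ 2)%:R * (((1 - a) + u (n.+1 ^ 2)%N) + (iota l - b ^+ 2)).
  by rewrite !natrM; ring.
by apply: (CD) => //; apply: (unital_coneMn _ uC); apply: (CD) => //; apply: (CD).
Qed.

Lemma archimedean_dagger_semiring B C : subalgebra iota B ->
  archimedean iota B C -> semiring iota B C \/ quadratic_module iota B C ->
  semiring iota B (dagger iota C).
Proof.
move=> sB aC [[uC CM]|qC].
  apply: dagger_semiring => // a b Ca Cb.
  by apply: (subset_dagger uC); apply: CM.
have [uC _] := qC; apply: dagger_semiring => // a b Ca Cb.
have [[CB Cs _] _] := uC.
have [l [l0 la _]] := aC _ (CB _ Ca).
have uD := dagger_unital_cone sB uC.
(* Rescale a so that it is at most 1. *)
have linv0 : 0 <= l^-1 by rewrite invr_ge0 ltW.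
apply: (@unital_cone_unscale B _ l^-1 _ uD); first by rewrite invr_gt0.
rewrite mulrA; apply: (quadratic_module_mul_unit sB qC aC) => //; first exact: Cs.
have -> : 1 - iota l^-1 * a = iota l^-1 * (iota l - a).
  by rewrite mulrBr -rmorphM mulVf ?rmorph1 ?gt_eqF.
exact: Cs.
Qed.

Lemma semiring_dagger_preordering C : semiring iota setT C ->
  archimedean iota setT C -> preordering iota setT (dagger iota C).
Proof.
move=> sC aC; have sT : subalgebra iota [set: A] by split.
have sD : semiring iota setT (dagger iota C).
  by apply: archimedean_dagger_semiring => //; left.
have [uD DM] := sD; split=> //; split=> // a b _ Db.
apply: DM => //; exact: (semiring_sqr_dagger sT sC aC).
Qed.

(** * Cones of products *)

Lemma cone_ind n (C : 'I_n -> set A) (S : set A) : S 0 ->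
  (forall x y, S x -> S y -> S (x + y)) ->
  (forall c, (forall i, C i (c i)) -> S (\prod_i c i)) -> cone C `<=` S.
Proof.
move=> S0 SD SP x [r [c [Cc ->]]].
by apply: big_ind => // k _; apply: SP.
Qed.

Lemma cone0 n (C : 'I_n -> set A) : cone C 0.
Proof.
exists 0, (fun _ _ => 0); split; first by move=> j [].
by rewrite big_ord0.
Qed.

Lemma cone_prod n (C : 'I_n -> set A) c : (forall i, C i (c i)) -> cone C (\prod_i c i).
Proof. by move=> Cc; exists 1, (fun j _ => c j); rewrite big_ord1. Qed.

Lemma coneD n (C : 'I_n -> set A) x y : cone C x -> cone C y -> cone C (x + y).
Proof.
move=> [r [c [Cc ->]]] [s [d [Cd ->]]].
exists (r + s)%N, (fun j k => match fintype.split k with inl k => c j k | inr k => d j k end).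
split; first by move=> j k; case: (fintype.split k).
rewrite big_split_ord /=; congr (_ + _); apply: eq_bigr => k _; apply: eq_bigr => j _.
  by rewrite (unsplitK (inl k)).
by rewrite (unsplitK (inr k)).
Qed.

Lemma cone_mono n (C D : 'I_n -> set A) : (forall i, C i `<=` D i) -> cone C `<=` cone D.
Proof. by move=> CD x [r [c [Cc ->]]]; exists r, c; split=> // j k; apply: (CD). Qed.

(** A set that multiplies one factor into itself multiplies the whole cone into
itself.  This serves for scalars and for the module property alike. *)
Lemma cone_factor n (C : 'I_n -> set A) k y :
  (forall c, C k c -> C k (c * y)) -> forall x, cone C x -> cone C (x * y).
Proof.
move=> Cy; apply: cone_ind => [|x1 x2 ? ?|c Cc].
- by rewrite /= mul0r; apply: cone0.
- by rewrite /= mulrDl; apply: coneD.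
rewrite /= (bigD1 k)//= mulrAC.
have -> : c k * y * \prod_(i | i != k) c i = \prod_i (if i == k then c k * y else c i).
  by rewrite [RHS](bigD1 k)//= eqxx; congr (_ * _); apply: eq_bigr => i /negPf ->.
by apply: cone_prod => i; case: eqP => [->|]; first exact: Cy.
Qed.

Lemma cone_mul n (C : 'I_n -> set A) :
  (forall i c d, C i c -> C i d -> C i (c * d)) ->
  forall x y, cone C x -> cone C y -> cone C (x * y).
Proof.
move=> CM x y Cx; move: y; apply: cone_ind => [|y1 y2 ? ?|d Cd].
- by rewrite /= mulr0; apply: cone0.
- by rewrite /= mulrDr; apply: coneD.
move: x Cx; apply: cone_ind => [|x1 x2 ? ?|c Cc].
- by rewrite /= mul0r; apply: cone0.
- by rewrite /= mulrDl; apply: coneD.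
by rewrite /= -big_split; apply: cone_prod => i; apply: CM.
Qed.

Lemma cone_unital n (B C : 'I_n -> set A) : (0 < n)%N ->
  (forall i, unital_cone iota (B i) (C i)) -> unital_cone iota setT (cone C).
Proof.
move=> n0 uC; split.
  split=> // [l c l0|c d]; last exact: coneD.
  rewrite mulrC; apply: (@cone_factor _ _ (Ordinal n0)) => d.
  by have [[_ Cs _] _] := uC (Ordinal n0); rewrite mulrC; apply: Cs.
have -> : 1 = \prod_(i < n) 1 :> A by rewrite big1.
by apply: cone_prod => i; have [] := uC i.
Qed.

(** To pass from products of factors in the F i to products of factors in the
larger sets G i, it suffices to change one factor at a time, w being the product
of the other factors. *)
Lemma factor_exchange n (F G : 'I_n -> set A) (S : set A) :
  (forall i, F i `<=` G i) ->
  (forall c, (forall i, F i (c i)) -> S (\prod_i c i)) ->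
  (forall k x w, (forall y, G k y -> cone G (y * w)) ->
     (forall y, F k y -> S (y * w)) -> G k x -> S (x * w)) ->
  forall c, (forall i, G i (c i)) -> S (\prod_i c i).
Proof.
move=> FG SF step.
(* The first j factors have been exchanged already. *)
suff H j c : (forall i : 'I_n, if (i < j)%N then G i (c i) else F i (c i)) ->
    S (\prod_i c i).
  by move=> c Gc; apply: (H n) => i; rewrite ltn_ord.
elim: j c => [|j IH] c Hc; first exact: SF.
have [jn|nj] := ltnP j n; last first.
  apply: IH => i; have ij := leq_trans (ltn_ord i) nj.
  by move: (Hc i); rewrite ltnS (ltnW ij) ij.
pose k := Ordinal jn.
pose c' y := [eta c with k |-> y].
have prodc' y : \prod_i c' y i = y * \prod_(i | i != k) c i.
  by rewrite (bigD1 k)//= eqxx; congr (_ * _); apply: eq_bigr => i /negPf ->.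
have Gc i : G i (c i) by move: (Hc i); case: ifP => // _; apply: FG.
rewrite (bigD1 k)//=; apply: (step k) => // y Hy; rewrite -prodc'.
  by apply: cone_prod => i /=; case: eqP => [->|].
apply: IH => i /=; case: eqP => [->|/eqP ik]; first by rewrite ltnn.
move: (Hc i); rewrite ltnS leq_eqVlt.
by rewrite -(inj_eq val_inj) /= in ik; rewrite (negPf ik).
Qed.

End Dagger.

(** * Cones of products of Archimedean cones *)

Section ConeOfArchimedean.
Variables (R : realType) (A : comPzRingType) (iota : {rmorphism R -> A}).
Variables (m : nat) (B C : 'I_m -> set A).

Lemma cone_subalgebra : (0 < m)%N -> (forall i, subalgebra iota (B i)) ->
  subalgebra iota (cone B).
Proof.
move=> m0 sB.
have [B1 Bs] : cone B 1 /\ forall l x, cone B x -> cone B (iota l * x).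
  split=> [|l x].
    have -> : 1 = \prod_(i < m) 1 :> A by rewrite big1.
    by apply: cone_prod => i; have [] := sB i.
  rewrite mulrC; apply: (@cone_factor _ _ _ (Ordinal m0)) => d Bd.
  by have [_ _ BM] := sB (Ordinal m0); apply: BM => //; apply: subalgebra_scalar.
split=> // [l a b Ba Bb|]; first by apply: coneD => //; apply: Bs.
by apply: cone_mul => i; have [] := sB i.
Qed.

(** As A is commutative, sums of products with one factor from each subalgebra
form a subalgebra; the remaining factors being 1, it contains every B k. *)
Lemma cone_generated : (0 < m)%N -> (forall i, subalgebra iota (B i)) ->
  generated_subalgebra iota B `<=` cone B.
Proof.
move=> m0 sB a; apply; split; first exact: cone_subalgebra.
move=> x [k _ Bx].
have -> : x = \prod_i (if i == k then x else 1).
  by rewrite (bigD1 k)//= eqxx big1 ?mulr1// => i /negPf ->.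
by apply: cone_prod => i; case: eqP => [->//|_]; have [] := sB i.
Qed.

(** Products of elements of the C i are bounded above by the product of
upper bounds of the factors, by telescoping.  A product of elements of the
B i reduces to these: x in B k is (l + x) - l, a difference of two elements of
C k. *)
Lemma cone_archimedean : (0 < m)%N -> (forall i, subalgebra iota (B i)) ->
  (forall i, unital_cone iota (B i) (C i)) ->
  (forall i, archimedean iota (B i) (C i)) ->
  archimedean iota (cone B) (cone C).
Proof.
move=> m0 sB uC aC.
have u0 := cone_unital m0 uC; have [[_ cs cD] c1] := u0.
(* Telescoping starts from the product whose factors are all 1. *)
have upper c : (forall i, C i (c i)) -> exists l, cone C (iota l - \prod_i c i).
  move: c; pose S x := exists l, cone C (iota l - x).
  apply: (@factor_exchange _ _ (fun=> [set 1]) _ S).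
  - by move=> i x ->; have [] := uC i.
  - move=> c c_1; exists 1; rewrite big1 => [|i _]; last exact: c_1.
    by rewrite rmorph1 subrr; apply: cone0.
  move=> k x w Cw /(_ 1 erefl)[mu]; rewrite mul1r => Cmu Cx.
  have [[CB _ _] _] := uC k; have [l [l0 lx _]] := aC k _ (CB _ Cx).
  exists (l * mu).
  have -> : iota (l * mu) - x * w = iota l * (iota mu - w) + (iota l - x) * w by ring.
  by apply: (cD); [apply: cs; rewrite ?ltW|apply: Cw].
have bC c : (forall i, C i (c i)) -> bounded iota (cone C) (\prod_i c i).
  move=> Cc; have [l Cl] := upper c Cc.
  exists (`|l| + 1); split; first by rewrite ltr_wpDl.
  - have -> : iota (`|l| + 1) - \prod_i c i
      = iota (`|l| - l + 1) + (iota l - \prod_i c i) by ring.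
    apply: (cD) => //; apply: (unital_cone_scalar u0).
    by rewrite addr_ge0// subr_ge0 ler_norm.
  - by apply: (cD); [apply: (unital_cone_scalar u0)|exact: cone_prod]; rewrite addr_ge0.
apply: (@cone_ind _ _ B (bounded iota (cone C))).
- by exists 1; rewrite subr0 addr0 rmorph1.
- by move=> x y; apply: boundedD u0.
apply: factor_exchange bC _; first by move=> i; have [[]] := uC i.
move=> k x w _ bw Bx; have [l [l0 _ Cx]] := aC k _ Bx.
have -> : x * w = (iota l + x) * w + iota (- l) * (1 * w) by ring.
apply: (boundedD u0); first exact: bw.
by apply: (bounded_scale _ u0); apply: bw; have [] := uC k.
Qed.

(** Replacing a factor x of the closure of C k by x + d with d > 0, which is in
C k, changes the product x w by d w; this is O(d) since w is bounded. *)
Lemma cone_dagger : (0 < m)%N ->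
  (forall i, unital_cone iota (B i) (C i)) ->
  archimedean iota setT (cone C) ->
  dagger iota (cone (fun i => dagger iota (C i))) = dagger iota (cone C).
Proof.
move=> m0 uC a0; have u0 := cone_unital m0 uC.
have CD i : C i `<=` dagger iota (C i) by apply: subset_dagger (uC i).
apply/seteqP; split; last by apply: dagger_mono; apply: cone_mono.
have sT : subalgebra iota [set: A] by split.
have uD := dagger_unital_cone sT u0; have [[_ _ DD] _] := uD.
have D0 := subset_dagger u0.
suff H : cone (fun i => dagger iota (C i)) `<=` dagger iota (cone C).
  by apply: subset_trans (dagger_mono H) _; exact: dagger_idem.
apply: cone_ind; [exact/D0/cone0|exact: DD|].
apply: (factor_exchange CD).
  by move=> c Cc; apply/D0/cone_prod.
move=> k x w _ Dw Dx; have [l [_ lw _]] := a0 w I.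
apply: dagger_idem; apply: (@dagger_of_multiples _ _ _ _ _ _ l uD) => n.
set d : R := n.+1%:R^-1.
have nd : n.+1%:R * iota d = 1 :> A.
  by rewrite -(rmorph_nat iota) -rmorphM mulfV ?rmorph1// pnatr_eq0.
have -> : n.+1%:R * (x * w) + iota l = n.+1%:R * ((x + iota d) * w) + (iota l - w).
  by rewrite mulrDl mulrDr [n.+1%:R * (iota d * _)]mulrA nd; ring.
apply: (DD); last exact: D0.
by apply: (unital_coneMn _ uD); apply/Dw/Dx; rewrite invr_gt0 ltr0n.
Qed.

End ConeOfArchimedean.

(** * The closure of the cone generated by several algebras *)

Theorem theorem5 (R : realType) (A : comPzRingType) (iota : {rmorphism R -> A})
    (m : nat) (B C : 'I_m -> set A) (M : set A)
    (m_gt0 : (0 < m)%N)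
    (subB : forall i, subalgebra iota (B i))
    (genB : generated_subalgebra iota B = setT)
    (archC : forall i, archimedean iota (B i) (C i))
    (semi_or_quad : forall i,
       semiring iota (B i) (C i) \/ quadratic_module iota (B i) (C i))
    (coneM : unital_cone iota setT M) :
  let P := dagger iota (cone C) in
  [/\ preordering iota setT P,
      archimedean iota setT P &
      cone_module iota P (cone2 M P)].
Proof.
move=> P.
have uC i : unital_cone iota (B i) (C i) by case: (semi_or_quad i) => [][].
have u0 := cone_unital m_gt0 uC.
have a0 : archimedean iota setT (cone C).
  move=> a _; apply: (cone_archimedean m_gt0 subB uC archC).
  by apply: (@cone_generated R A iota m B m_gt0 subB); rewrite genB.
have CP : cone C `<=` P by apply: subset_dagger u0.
have aP : archimedean iota setT P.
  by move=> a /a0[l [l0 ? ?]]; exists l; split=> //; apply: CP.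
(* P is the closure of T as well, and T is closed under products. *)
pose T := cone (fun i => dagger iota (C i)).
have sD i := archimedean_dagger_semiring (subB i) (archC i) (semi_or_quad i).
have sT : semiring iota setT T.
  split; first by apply: (cone_unital m_gt0) => i; exact: (sD i).1.
  by apply: cone_mul => i; exact: (sD i).2.
have CT : cone C `<=` T.
  by apply: cone_mono => i; apply: subset_dagger (uC i).
have aT : archimedean iota setT T.
  by move=> a /a0[l [l0 ? ?]]; exists l; split=> //; apply: CT.
have pP : preordering iota setT P.
  by rewrite /P -(cone_dagger m_gt0 uC a0); exact: semiring_dagger_preordering.
have [_ sP] := pP; have [uP PM] := sP.
split=> //; split=> //.
  apply: (@cone_unital _ _ _ _ (fun=> setT)) => // i.
  by case: i => [[|[|//]] ?].
(* Multiplication by c acts on the factor from P, which has index 1. *)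
move=> a c Na Pc; apply: (@cone_factor _ _ _ (inord 1)) => // d.
by rewrite (tnth_nth M) inordK//= => Pd; exact: PM.
Qed.
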